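(* Every real symmetric matrix $A \in \mathbb{R}^{n\times n}$ is Schur-Horn continuous.
   Context: $\|\cdot\|_{\mathrm F}$ is the Frobenius norm. For $x\in\mathbb{R}^n$, $x^{\uparrow}$ denotes the vector $x$ reordered with entries in non-decreasing order. For $a,\lambda\in\mathbb{R}^n$ we write $\lambda\prec a$ if $\sum_{i=1}^k \lambda_i^{\uparrow}\le \sum_{i=1}^k a_i^{\uparrow}$ for $k=1,\dots,n-1$ and $\sum_{i=1}^n\lambda_i^{\uparrow}=\sum_{i=1}^n a_i^{\uparrow}$. Big-$O$ convention: $\varepsilon>0$ is the asymptotic variable tending to zero; perturbed quantities are families indexed by sufficiently small $\varepsilon>0$; all other data (matrix dimension, the matrix $A$) are constants. Definition (Schur-Horn continuity, real symmetric case). Let $A$ be an $n\times n$ real symmetric matrix with eigenvalues $\lambda\in\mathbb{R}^n$ and diagonal entries $d\in\mathbb{R}^n$. $A$ is Schur-Horn continuous if the following holds: whenever $\tilde\lambda$ is a perturbation of $\lambda$ such that $\|\lambda-\tilde\lambda\|_2=O(\varepsilon)$ for $\varepsilon>0$ sufficiently small and $\tilde\lambda\prec d$, there exists a real symmetric matrix $\widetilde B$ with eigenvalues $\tilde\lambda$ and diagonal entries $d$ such that $\|A-\widetilde B\|_{\mathrm F}=O(\varepsilon^{1/2})$. *)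

(* Defs.v *)
From mathcomp Require Import all_boot all_order all_algebra.
From mathcomp Require Import all_classical all_reals all_analysis.
Import Order.TTheory GRing.Theory Num.Theory.
Import numFieldNormedType.Exports.

Set Implicit Arguments.
Unset Strict Implicit.
Unset Printing Implicit Defensive.

Local Open Scope classical_set_scope.
Local Open Scope ring_scope.

(* The library norm `|M| on matrices is the max norm, hence this definition.
   On row vectors (m = 1) it is the Euclidean norm. *)
Definition frob_norm (R : realType) (m n : nat) (M : 'M[R]_(m, n)) : R :=
  Num.sqrt (\sum_(i < m) \sum_(j < n) M i j ^+ 2).

Definition l2_norm (R : realType) (n : nat) (x : 'rV[R]_n) : R := frob_norm x.

Definition sort_up (R : realType) (n : nat) (x : 'rV[R]_n) : 'rV[R]_n :=
  \row_(i < n) (sort <=%R [seq x 0 j | j : 'I_n])`_i.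

(* [majorized l a] is l \prec a for partial sums of the smallest entries;
   with this orientation the vector of eigenvalues is on the left and the
   vector of diagonal entries on the right. *)
Definition majorized (R : realType) (n : nat) (l a : 'rV[R]_n) : Prop :=
  (forall k : nat, (0 < k < n)%N ->
     \sum_(i < n | (i < k)%N) sort_up l 0 i
       <= \sum_(i < n | (i < k)%N) sort_up a 0 i)
  /\ \sum_(i < n) sort_up l 0 i = \sum_(i < n) sort_up a 0 i.

(* l lists the eigenvalues of A with multiplicity, in any order. *)
Definition has_eigenvalues (R : realType) (n : nat) (A : 'M[R]_n)
    (l : 'rV[R]_n) : Prop :=
  char_poly A = \prod_(i < n) ('X - (l 0 i)%:P).

Definition diag_entries (R : realType) (n : nat) (A : 'M[R]_n) : 'rV[R]_n :=
  \row_(i < n) A i i.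

(* Perturbed quantities are families indexed by e > 0; only their values for
   sufficiently small e (the filter 0^'+) are constrained. *)
Definition schur_horn_continuous (R : realType) (n : nat) (A : 'M[R]_n) :
    Prop :=
  forall (lam : 'rV[R]_n), has_eigenvalues A lam ->
  forall (lamt : R -> 'rV[R]_n),
    (fun e : R => l2_norm (lam - lamt e)) =O_ (0^'+) (fun e : R => e) ->
    (\forall e \near 0^'+, majorized (lamt e) (diag_entries A)) ->
  exists Bt : R -> 'M[R]_n,
    (\forall e \near 0^'+,
       [/\ (Bt e)^T = Bt e, has_eigenvalues (Bt e) (lamt e)
         & diag_entries (Bt e) = diag_entries A]) /\
    (fun e : R => frob_norm (A - Bt e)) =O_ (0^'+) (fun e : R => Num.sqrt e).

(* Main.v *)
(* Write A = Q^T (diag l) Q with Q block diagonal for the connected components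
   of the graph of A, and let d be the diagonal of A and lt the perturbed
   spectrum. Since lt is majorized by d and l sums to the same values as d over
   unions of components, a point c = l + O(eps) (d - l) of the segment from l to
   d majorizes lt. The Schur-Horn theorem gives M with spectrum lt and diagonal
   c, and then |M - diag l|^2 = |lt|^2 + |l|^2 - 2 <c, l> = O(eps), whatever M.
   So Q^T M Q lies within O(eps^(1/2)) of A and has the right trace on each
   component. Finally the diagonal is corrected one vertex at a time, from the
   leaves of a spanning forest to its roots, by rotations in the planes of edges
   of the graph, whose angles are linear in the error because the corresponding
   entries of A do not vanish. *)
Require Import Defs.
From mathcomp Require Import all_boot all_order all_algebra.
From mathcomp Require Import all_classical all_reals all_analysis.
From mathcomp Require Import perm.
From mathcomp Require Import ring lra.
Import Order.TTheory GRing.Theory Num.Theory.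
Import numFieldNormedType.Exports.

Set Implicit Arguments.
Unset Strict Implicit.
Unset Printing Implicit Defensive.

Local Open Scope ring_scope.

(** * Orthogonal and block diagonal matrices *)

Definition orthogonal_mx (R : pzRingType) (n : nat) (Q : 'M[R]_n) : Prop :=
  Q *m Q^T = 1%:M.

(* f labels the diagonal blocks: X is block diagonal up to a permutation. *)
Definition supported (R : pzRingType) (n : nat) (T : eqType) (f : 'I_n -> T)
    (X : 'M[R]_n) : Prop :=
  forall i j, f i != f j -> X i j = 0.

Section Orthogonal.
Variables (R : comUnitRingType) (n : nat).
Implicit Types P Q X : 'M[R]_n.

Lemma orthogonal_mx_tr_mul Q : orthogonal_mx Q -> Q^T *m Q = 1%:M.
Proof. exact: mulmx1C. Qed.

Lemma orthogonal_mx_tr Q : orthogonal_mx Q -> orthogonal_mx Q^T.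
Proof. by move=> oQ; rewrite /orthogonal_mx trmxK; apply: mulmx1C. Qed.

Lemma orthogonal_mx1 : orthogonal_mx (1%:M : 'M[R]_n).
Proof. by rewrite /orthogonal_mx trmx1 mulmx1. Qed.

Lemma orthogonal_mxM P Q :
  orthogonal_mx P -> orthogonal_mx Q -> orthogonal_mx (P *m Q).
Proof.
rewrite /orthogonal_mx => oP oQ.
by rewrite trmx_mul -mulmxA (mulmxA Q) oQ mul1mx.
Qed.

Lemma conjmx_sym Q X : X^T = X -> (Q *m X *m Q^T)^T = Q *m X *m Q^T.
Proof. by move=> sX; rewrite !trmx_mul trmxK sX mulmxA. Qed.

Lemma char_poly_conj Q X :
  orthogonal_mx Q -> char_poly (Q *m X *m Q^T) = char_poly X.
Proof.
move=> oQ; rewrite /char_poly /char_poly_mx !map_mxM /=.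
have oQ' : map_mx polyC Q *m map_mx polyC Q^T = 1%:M.
  by rewrite -map_mxM /= oQ map_mx1.
have -> : 'X%:M - map_mx polyC Q *m map_mx polyC X *m map_mx polyC Q^T =
    map_mx polyC Q *m ('X%:M - map_mx polyC X) *m map_mx polyC Q^T.
  by rewrite mulmxBr mulmxBl mul_mx_scalar -scalemxAl oQ' scalemx1.
by rewrite !det_mulmx mulrAC -det_mulmx oQ' det1 mul1r.
Qed.

Lemma char_poly_diag (l : 'rV[R]_n) :
  char_poly (diag_mx l) = \prod_(i < n) ('X - (l 0 i)%:P).
Proof.
rewrite char_poly_trig; last exact/diag_mx_is_trig.
by apply: eq_bigr => i _; rewrite mxE eqxx mulr1n.
Qed.

End Orthogonal.

Section Supported.
Variables (R : comPzRingType) (n : nat) (T : eqType) (f : 'I_n -> T).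
Implicit Types P Q X : 'M[R]_n.

Lemma supportedM P Q : supported f P -> supported f Q -> supported f (P *m Q).
Proof.
move=> sP sQ i j fij; rewrite mxE big1 // => k _.
have [fik|fik] := eqVneq (f i) (f k); last by rewrite sP ?mul0r.
by rewrite sQ ?mulr0 // -fik.
Qed.

Lemma supported_tr Q : supported f Q -> supported f Q^T.
Proof. by move=> sQ i j fij; rewrite mxE sQ // eq_sym. Qed.

Lemma supported1 : supported f (1%:M : 'M[R]_n).
Proof.
move=> i j fij; rewrite mxE; case: eqVneq => // ij.
by rewrite ij eqxx in fij.
Qed.

(* Q commutes with the projection onto the coordinates in S. *)
Lemma sum_diag_conj (S : pred 'I_n) Q X :
  Q^T *m Q = 1%:M -> supported f Q ->
  (forall i j, f i = f j -> S i = S j) ->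
  \sum_(i | S i) (Q *m X *m Q^T) i i = \sum_(i | S i) X i i.
Proof.
move=> oQ sQ fS.
pose D : 'M[R]_n := diag_mx (\row_i (S i)%:R).
have DE (Y : 'M[R]_n) : \sum_(i | S i) Y i i = \tr (D *m Y).
  rewrite /mxtrace big_mkcond /=; apply: eq_bigr => i _.
  rewrite mul_diag_mx !mxE; case: (S i); by rewrite ?mul1r ?mul0r.
have DQ : D *m Q = Q *m D.
  apply/matrixP => i j; rewrite mul_diag_mx mul_mx_diag !mxE mulrC.
  have [fij|fij] := eqVneq (f i) (f j); first by rewrite (fS _ _ fij).
  by rewrite sQ // !mul0r.
rewrite (DE (Q *m X *m Q^T)) (DE X) !mulmxA DQ mxtrace_mulC !mulmxA.
by rewrite oQ mul1mx.
Qed.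

End Supported.

Lemma mxtrace_mul_tr (R : pzRingType) (m n : nat) (M : 'M[R]_(m, n)) :
  \tr (M *m M^T) = \sum_i \sum_j M i j * M i j.
Proof.
by apply: eq_bigr => i _; rewrite mxE; apply: eq_bigr => j _; rewrite mxE.
Qed.

(** * Givens rotations *)

Section Givens.
Variables (R : comNzRingType) (n : nat) (i j : 'I_n).
Hypothesis ij : i != j.

Definition givens (c s : R) : 'M[R]_n :=
  1%:M + (c - 1) *: (delta_mx i i + delta_mx j j)
       + s *: (delta_mx i j - delta_mx j i).

Lemma givens_orthogonal c s : c ^+ 2 + s ^+ 2 = 1 ->
  orthogonal_mx (givens c s).
Proof.
move=> cs1; rewrite /orthogonal_mx.
have -> : (givens c s)^T = 1%:M + (c - 1) *: (delta_mx i i + delta_mx j j)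
       - s *: (delta_mx i j - delta_mx j i).
  by apply/matrixP => a b; rewrite !mxE (eq_sym b a) !(andbC (b == _)); ring.
(* [E] projects onto the plane of [i] and [j] and [F] generates its rotations. The four products
   below collapse the claim to [(c ^+ 2 + s ^+ 2 - 1) *: E = 0]. *)
set E := _ + delta_mx j j; set F := delta_mx i j - _.
have EE : E *m E = E.
  rewrite /E mulmxDl !mulmxDr !mul_delta_mx_cond !eqxx (eq_sym j) (negbTE ij).
  by rewrite !mulr1n !mulr0n addr0 add0r.
have FF : F *m F = - E.
  rewrite /F mulmxBl !mulmxBr !mul_delta_mx_cond !eqxx (eq_sym j) (negbTE ij).
  by rewrite !mulr1n !mulr0n !sub0r subr0 /E opprD addrC.
have EF : E *m F = F.
  rewrite /F /E mulmxDl !mulmxBr !mul_delta_mx_cond !eqxx (eq_sym j).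
  rewrite (negbTE ij).
  by rewrite !mulr1n !mulr0n subr0 sub0r.
have FE : F *m E = F.
  rewrite /F /E mulmxBl !mulmxDr !mul_delta_mx_cond !eqxx (eq_sym j).
  rewrite (negbTE ij).
  by rewrite !mulr1n !mulr0n addr0 add0r.
rewrite /givens -/E -/F !mulmxDl !mulmxBr !mulmxDr ?mulmxBr !(mul1mx, mulmx1).
rewrite -!scalemxAl -!scalemxAr EE FF EF FE !scalerA scalerN.
clearbody E F; apply/matrixP => a b; rewrite !mxE.
have cs0 : c ^+ 2 + s ^+ 2 - 1 = 0 by rewrite cs1 subrr.
by rewrite -[RHS]addr0 -[X in _ = _ + X](mul0r (E a b)) -cs0; ring.
Qed.

Lemma givens_supported (T : eqType) (f : 'I_n -> T) c s :
  f i = f j -> supported f (givens c s).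
Proof.
move=> fij a b fab; rewrite !mxE.
have ab : a == b = false by apply: contraNF fab => /eqP->.
have h x y : f x = f y -> (a == x) && (b == y) = false.
  by move=> fxy; apply: contraNF fab => /andP[/eqP-> /eqP->]; apply/eqP.
by rewrite ab !h // ?addr0 ?subr0 ?mulr0 ?addr0.
Qed.

Lemma givens_row_pivot c s (M : 'M[R]_n) b :
  (givens c s *m M) i b = c * M i b + s * M j b.
Proof.
rewrite /givens !mulmxDl mul1mx -!scalemxAl mulmxDl mulmxBl !mxE.
have dE (x y : 'I_n) :
    \sum_k (delta_mx x y : 'M[R]_n) i k * M k b = (i == x)%:R * M y b.
  rewrite (bigD1 y) //= big1 ?addr0 ?mxE ?eqxx ?andbT // => k ky.
  by rewrite mxE (negbTE ky) andbF mul0r.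
rewrite !dE eqxx (negbTE ij) /=; ring.
Qed.

Lemma givens_row_other c s (M : 'M[R]_n) a b :
  a != i -> a != j -> (givens c s *m M) a b = M a b.
Proof.
move=> ai aj; rewrite /givens !mulmxDl mul1mx -!scalemxAl mulmxDl mulmxBl !mxE.
have dE (x y : 'I_n) :
    \sum_k (delta_mx x y : 'M[R]_n) a k * M k b = (a == x)%:R * M y b.
  rewrite (bigD1 y) //= big1 ?addr0 ?mxE ?eqxx ?andbT // => k ky.
  by rewrite mxE (negbTE ky) andbF mul0r.
rewrite !dE (negbTE ai) (negbTE aj) /=; ring.
Qed.

Lemma givens_diag_pivot c s (M : 'M[R]_n) : M^T = M ->
  (givens c s *m M *m (givens c s)^T) i i =
  c ^+ 2 * M i i + c * s * M i j *+ 2 + s ^+ 2 * M j j.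
Proof.
move=> sM; set G := givens c s.
have -> : G *m M *m G^T = G *m (G *m M)^T by rewrite trmx_mul sM mulmxA.
have tE a b : (G *m M)^T a b = (G *m M) b a by rewrite mxE.
rewrite givens_row_pivot !tE !givens_row_pivot.
have -> : M j i = M i j by rewrite -{1}sM mxE.
ring.
Qed.

Lemma givens_diag_other c s (M : 'M[R]_n) k : M^T = M ->
  k != i -> k != j -> (givens c s *m M *m (givens c s)^T) k k = M k k.
Proof.
move=> sM ki kj; set G := givens c s.
have -> : G *m M *m G^T = G *m (G *m M)^T by rewrite trmx_mul sM mulmxA.
by rewrite givens_row_other // mxE givens_row_other.
Qed.

End Givens.

(* With x, y the diagonal entries and b the off-diagonal one, this is the
   quadratic equation for tan = s / c, solved by its smaller root. *)
Lemma rotation_angle (R : rcfType) (x y b t : R) :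
  0 <= b ^+ 2 + t * (y - x - t) ->
  exists c s : R, [/\ c ^+ 2 + s ^+ 2 = 1,
    c ^+ 2 * x + c * s * b *+ 2 + s ^+ 2 * y = x + t,
    0 <= c & `|b| * `|s| <= `|t| ].
Proof.
move=> D0; set g := y - x - t; set r := Num.sqrt (b ^+ 2 + t * g).
have r0 : 0 <= r by rewrite sqrtr_ge0.
have rr : r ^+ 2 = b ^+ 2 + t * g by rewrite sqr_sqrtr.
(* Writing the tangent as [t / q] turns its equation into [q ^+ 2 = 2 b q + t g]. The root whose
   square root term has the sign of [b] avoids cancellation, whence [|b| <= |q|]. *)
have [q [qq bq]] : exists q, q ^+ 2 = b * q *+ 2 + t * g /\ `|b| <= `|q|.
  have [b0|b0] := leP 0 b.
    exists (b + r); split; first by rewrite sqrrD rr; ring.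
    by rewrite ger0_norm // ger0_norm ?addr_ge0 // lerDl.
  exists (b - r); split; first by rewrite sqrrB rr; ring.
  by rewrite ltr0_norm // ler0_norm; lra.
(* Degenerate case: [b = 0] and [t * g = 0]. The identity serves if [t = 0]; otherwise [y = x + t]
   and a quarter turn exchanges the two entries. *)
have [q0|q0] := eqVneq q 0.
  have b0 : b = 0.
    by apply/eqP; rewrite -normr_le0; apply: le_trans bq _; rewrite q0 normr0.
  have tg : t * g = 0.
    by move: qq; rewrite q0 expr0n /= mulr0 mul0rn add0r.
  have [t0|t0] := eqVneq t 0.
    exists 1, 0; rewrite t0 b0 !normr0; split; by [ring | | rewrite mulr0].
  exists 0, 1; split; [ring| |exact: lexx|by rewrite b0 normr0 mul0r].
  move/eqP: tg; rewrite mulf_eq0 (negbTE t0) /= => /eqP; rewrite /g; lra.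
pose h := Num.sqrt (q ^+ 2 + t ^+ 2).
have hh : h ^+ 2 = q ^+ 2 + t ^+ 2 by rewrite sqr_sqrtr // addr_ge0 ?sqr_ge0.
have q2 : 0 < q ^+ 2 by rewrite exprn_even_gt0.
have h0 : 0 < h by rewrite sqrtr_gt0 ltr_wpDr ?sqr_ge0.
have hn0 : h != 0 by rewrite gt_eqF.
have hq : `|q| <= h.
  rewrite -ler_sqr ?nnegrE ?normr_ge0 ?(ltW h0) //=.
  by rewrite hh real_normK ?num_real // lerDl sqr_ge0.
have keyid : q ^+ 2 * x + q * t * b *+ 2 + t ^+ 2 * y = (x + t) * h ^+ 2.
  rewrite hh; apply/eqP; rewrite -subr_eq0; apply/eqP.
  rewrite [LHS](_ : _ = t * (b * q *+ 2 + t * g - q ^+ 2)); last first.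
    by rewrite /g; ring.
  by rewrite qq subrr mulr0.
(* Carrying the sign of [q] in the sine keeps the tangent [t / q] and makes the cosine
   nonnegative. *)
have sg2 : Num.sg q ^+ 2 = 1 by rewrite sqr_sg q0.
exists (`|q| / h), (Num.sg q * t / h).
have cE : `|q| = Num.sg q * q by rewrite normrEsg.
split.
- rewrite !exprMn exprVn real_normK ?num_real // sg2 mul1r -mulrDl -hh divff //.
  by rewrite sqrf_eq0.
- have -> : (`|q| / h) ^+ 2 * x + `|q| / h * (Num.sg q * t / h) * b *+ 2 +
     (Num.sg q * t / h) ^+ 2 * y =
     Num.sg q ^+ 2 * ((q ^+ 2 * x + q * t * b *+ 2 + t ^+ 2 * y) / h ^+ 2).
    by rewrite cE; field.
  by rewrite sg2 mul1r keyid mulfK // sqrf_eq0.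
- by rewrite divr_ge0 // ltW.
- rewrite !normrM normr_sg q0 mul1r normfV (gtr0_norm h0).
  rewrite mulrA ler_pdivrMr // mulrC ler_wpM2l //.
  exact: le_trans bq hq.
Qed.

(** * The Schur-Horn theorem *)

(* The pairs (j, k) found here are those of the Hardy-Littlewood-Polya
   T-transforms. *)
Lemma prefix_sum_transfer (R : realDomainType) (n : nat) (z : 'I_n -> R) :
  (forall m, 0 <= \sum_(i < n | (i < m)%N) z i) -> \sum_(i < n) z i = 0 ->
  (exists i, z i != 0) ->
  exists j k : 'I_n, [/\ (j < k)%N, 0 < z j, z k < 0 &
    forall m : nat, (j < m <= k)%N -> z j <= \sum_(i < n | (i < m)%N) z i].
Proof.
move=> zpre zsum [i0 zi0].
have [k0 zk0] : exists k, z k < 0.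
  apply/existsP; apply: contraNT zi0; rewrite negb_exists => /forallP zge.
  have z0 i : true -> 0 <= z i by move=> _; rewrite leNgt.
  by apply/eqP; apply/(psumr_eq0P z0).
(* [k] is the first negative position. The prefix sum through [k] is nonnegative, so some positive
   entry precedes it; [j] will be the last such one. *)
pose k := [arg min_(k < k0 | (z k < 0)%R) (k : nat)]%N.
have [zk kmin] : z k < 0 /\ forall i : 'I_n, (i < k)%N -> 0 <= z i.
  rewrite /k; case: arg_minnP => // k' zk' kmin'; split=> // i ik.
  by rewrite leNgt; apply/negP => /kmin'; rewrite leqNgt ik.
have [j0 /andP[j0k zj0]] : exists j : 'I_n, (j < k)%N && (0 < z j).
  apply/existsP; apply: contraT; rewrite negb_exists => /forallP zle.
  have := zpre k.+1; rewrite (bigD1 k) //= big1 ?addr0.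
    by rewrite leNgt zk.
  move=> i /andP[ik ink]; have ik' : (i < k)%N by rewrite ltn_neqAle ink -ltnS.
  apply/eqP; rewrite eq_le kmin // andbT leNgt.
  by have := zle i; rewrite ik' /= => /negbTE->.
pose j := [arg max_(j > j0 | (j < k)%N && (0 < z j)%R) (j : nat)]%N.
have [jk zj jmax] : [/\ (j < k)%N, 0 < z j &
    forall i : 'I_n, (j < i < k)%N -> z i = 0].
  rewrite /j; case: arg_maxnP => [|j' /andP[j'k zj'] jmax'].
    by rewrite j0k.
  split=> // i /andP[ji ik]; apply/eqP; rewrite eq_le kmin // andbT leNgt.
  apply/negP => zi; have := jmax' i; rewrite ik zi => /(_ isT) /=.
  by rewrite leqNgt ji.
exists j, k; split=> // m /andP[jm mk].
(* Entries strictly between [j] and [k] vanish, so this prefix sum is [z j] plus the nonnegative sum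
   before [j]. *)
rewrite (bigID (fun i : 'I_n => i < j.+1)%N) /=.
rewrite [X in _ + X]big1 ?addr0; last first.
  move=> i /andP[im]; rewrite -leqNgt => ji; apply: jmax.
  by rewrite ji (leq_trans im).
rewrite (eq_bigl (fun i : 'I_n => (i < j)%N || (i == j))); last first.
  move=> i; rewrite ltnS -val_eqE /=; case: (ltngtP i j) => [ij|ij|ij].
  - by rewrite andbT (ltn_trans ij jm).
  - by rewrite andbF.
  - by rewrite andbT ij jm.
rewrite (bigD1 j) ?eqxx ?orbT //= lerDl.
rewrite (eq_bigl (fun i : 'I_n => (i < j)%N)) ?zpre // => i.
rewrite -val_eqE /=; by case: ltngtP.
Qed.

(** Induction on the number of wrong diagonal entries: a rotation transfers some amount from entry
    [k] to entry [j], makes at least one of them right and leaves the other diagonal entries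
    alone. *)
Lemma schur_horn_prefix (R : rcfType) (n : nat) (x : 'I_n -> R) (M : 'M[R]_n) :
  M^T = M -> (forall i j : 'I_n, (i <= j)%N -> x i <= x j) ->
  (forall m, \sum_(i < n | (i < m)%N) M i i <= \sum_(i < n | (i < m)%N) x i) ->
  \sum_i M i i = \sum_i x i ->
  exists P : 'M[R]_n, orthogonal_mx P /\ forall i, (P *m M *m P^T) i i = x i.
Proof.
move=> sM xmono.
have [N] := ubnP #|[pred i | M i i != x i]|.
elim: N M sM => // N IH M sM; rewrite ltnS => leN xpre xsum.
have [/forallP eqx|] := boolP [forall i, M i i == x i].
  exists 1%:M; split; first exact: orthogonal_mx1.
  by move=> i; rewrite mul1mx trmx1 mulmx1; apply/eqP.
rewrite negb_forall => /existsP[i0 neqi0].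
pose z i := x i - M i i.
have zpre m : 0 <= \sum_(i < n | (i < m)%N) z i by rewrite sumrB subr_ge0.
have zsum : \sum_(i < n) z i = 0 by rewrite sumrB xsum subrr.
have [|j [k [jk zj zk zjk]]] := prefix_sum_transfer zpre zsum.
  by exists i0; rewrite subr_eq0 eq_sym.
(* The largest transfer overshooting neither target, so that one of the two becomes exact. *)
pose t := Num.min (z j) (- z k).
have t0 : 0 < t by rewrite lt_min zj oppr_gt0.
have [tj tk] : t <= z j /\ t <= - z k by rewrite !ge_min !lexx orbT.
have xjk : x j <= x k by apply/xmono/ltnW.
have jnk : j != k by rewrite -val_eqE /= ltn_eqF.
have [c [s [cs1 cst _ _]]] : exists c s : R, [/\ c ^+ 2 + s ^+ 2 = 1,
    c ^+ 2 * M j j + c * s * M j k *+ 2 + s ^+ 2 * M k k = M j j + t,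
    0 <= c & `|M j k| * `|s| <= `|t| ].
  (* [M k k - M j j - t] equals [(x k - x j) + (z j - t) - z k], a sum of nonnegative terms. *)
  apply: rotation_angle; rewrite addr_ge0 ?sqr_ge0 // mulr_ge0 ?(ltW t0) //.
  rewrite /z in tj tk; lra.
pose G := givens j k c s; pose M' := G *m M *m G^T.
have oG : orthogonal_mx G by exact: givens_orthogonal.
have M'j : M' j j = M j j + t by rewrite /M' givens_diag_pivot.
have M'o i : i != j -> i != k -> M' i i = M i i.
  by move=> ij ik; rewrite /M' givens_diag_other.
have M'sum : \sum_i M' i i = \sum_i M i i.
  apply: (@sum_diag_conj _ _ _ (fun=> tt) predT) => //.
    exact: orthogonal_mx_tr_mul.
have M'k : M' k k = M k k - t.
  move: M'sum; rewrite (bigD1 k) //= [RHS](bigD1 k) //=.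
  rewrite (bigD1 j) //= [X in _ = _ + X](bigD1 j) //= M'j.
  rewrite (eq_bigr (fun i => M i i)); last first.
    by move=> i /andP[ik ij]; rewrite M'o.
  set rest := \sum_(i < n | _) _ => h.
  by apply: (addIr (M j j + t + rest)); rewrite h; ring.
have zM' i : x i - M' i i = z i - t *+ (i == j) + t *+ (i == k).
  have [->|ij] := eqVneq i j.
    by rewrite M'j (negbTE jnk) mulr0n mulr1n /z; ring.
  have [->|ik] := eqVneq i k; first by rewrite M'k mulr0n mulr1n /z; ring.
  by rewrite M'o // !mulr0n subr0 addr0.
have sM' : M'^T = M' by exact: conjmx_sym.
have [|||P [oP dP]] := IH M' sM'.
- apply: leq_trans leN; apply: proper_card; apply/properP; split.
    apply/fintype.subsetP => i; rewrite !inE; apply: contraNneq => Mi.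
    have [ij|ij] := eqVneq i j.
      by move: zj; rewrite /z -ij Mi subrr ltxx.
    have [ik|ik] := eqVneq i k.
      by move: zk; rewrite /z -ik Mi subrr ltxx.
    by rewrite M'o // Mi.
  have [ztj|ztj] := leP (z j) (- z k).
    exists j; rewrite !inE ?M'j.
      by rewrite eq_sym -subr_eq0 gt_eqF.
    by rewrite negbK /t min_l // /z subrKC.
  exists k; rewrite !inE ?M'k.
    by rewrite eq_sym -subr_eq0 lt_eqF.
  by rewrite negbK /t min_r ?ltW // opprK /z subrKC.
(* Only prefixes containing [j] but not [k] lose [t], and those sums are at least [z j]. *)
- move=> m; rewrite -subr_ge0 -sumrB (eq_bigr _ (fun i _ => zM' i)).
  have dl (l : 'I_n) : \sum_(i < n | (i < m)%N) t *+ (i == l) = t *+ (l < m)%N.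
    rewrite big_mkcond (bigD1 l) //= eqxx mulr1n big1 ?addr0.
      by case: ifP.
    by move=> i il; rewrite (negbTE il) mulr0n if_same.
  rewrite big_split sumrB /= !dl.
  have [km|mk] := ltnP k m; first by rewrite (ltn_trans jk km) subrK zpre.
  rewrite mulr0n addr0; have [jm|jm] := ltnP j m; last by rewrite subr0 zpre.
  by rewrite subr_ge0 mulr1n (le_trans tj) // zjk // jm mk.
- by rewrite M'sum.
exists (P *m G); split; first exact: orthogonal_mxM.
by move=> i; rewrite trmx_mul -dP /M' !mulmxA.
Qed.

(** * Spectral theorem for block diagonal matrices *)

(** Apply the linear factors of the annihilating polynomial to [x] one at a time: the last nonzero
    vector is an eigenvector, and it is still in [U]. *)
Lemma invariant_eigenvector (F : fieldType) (n : nat) (B : 'M[F]_n.+1)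
    (s : seq F) (U : 'rV[F]_n.+1 -> Prop) (x : 'rV[F]_n.+1) :
  (forall y a, U y -> U (y *m B - a *: y)) -> U x -> x != 0 ->
  x *m horner_mx B (\prod_(a <- s) ('X - a%:P)) = 0 ->
  exists (a : F) (y : 'rV[F]_n.+1), [/\ U y, y != 0 & y *m B = a *: y].
Proof.
move=> Uinv; elim: s x => [|a s IH] x Ux x0.
  by rewrite big_nil rmorph1 mulmx1 => /eqP; rewrite (negbTE x0).
rewrite big_cons rmorphM rmorphB /= horner_mx_X horner_mx_C mulmxA mulmxBr.
rewrite mul_mx_scalar => hx.
have [y0|y0] := eqVneq (x *m B - a *: x) 0.
  by exists a, x; split=> //; apply/eqP; rewrite -subr_eq0 y0.
exact: IH (Uinv _ _ Ux) y0 hx.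
Qed.

Section Householder.
Variables (R : realFieldType) (n : nat).
Implicit Types w y : 'rV[R]_n.

Definition dotmx w y : R := (w *m y^T) 0 0.

Lemma dotmxE w y : w *m y^T = (dotmx w y)%:M.
Proof. exact: mx11_scalar. Qed.

Lemma dotmx_sum w y : dotmx w y = \sum_i w 0 i * y 0 i.
Proof. by rewrite /dotmx mxE; apply: eq_bigr => i _; rewrite mxE. Qed.

Lemma dotmx_ge0 w : 0 <= dotmx w w.
Proof. by rewrite dotmx_sum sumr_ge0 // => i _; rewrite -expr2 sqr_ge0. Qed.

Lemma dotmx_eq0 w : (dotmx w w == 0) = (w == 0).
Proof.
apply/idP/eqP => [|->]; last by rewrite /dotmx mul0mx mxE.
rewrite dotmx_sum psumr_eq0 => [/allP w0|i _]; last by rewrite -expr2 sqr_ge0.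
apply/rowP => i; have := w0 i (mem_index_enum _).
by rewrite mxE /= -expr2 sqrf_eq0 => /eqP.
Qed.

(* For w = 0 the junk value of the inverse makes this the identity. *)
Definition householder w : 'M[R]_n := 1%:M - (2 / dotmx w w) *: (w^T *m w).

Lemma householder_sym w : (householder w)^T = householder w.
Proof. by rewrite /householder linearB linearZ /= trmx1 trmx_mul trmxK. Qed.

Lemma mul_householder y w :
  y *m householder w = y - (2 * dotmx y w / dotmx w w) *: w.
Proof.
rewrite mulmxBr mulmx1 -scalemxAr mulmxA dotmxE mul_scalar_mx scalerA.
by congr (_ - _ *: _); ring.
Qed.

Lemma householderK w : householder w *m householder w = 1%:M.
Proof.
have [->|w0] := eqVneq w 0.
  by rewrite /householder mulmx0 scaler0 subr0 mulmx1.
have ww0 : dotmx w w != 0 by rewrite dotmx_eq0.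
have wH : w *m householder w = - w.
  by rewrite mul_householder mulfK // scaler_nat mulr2n opprD addNKr.
by rewrite {1}/householder mulmxBl mul1mx -scalemxAl -mulmxA wH mulmxN scalerN
           opprK subrK.
Qed.

Lemma householder_orthogonal w : orthogonal_mx (householder w).
Proof. by rewrite /orthogonal_mx householder_sym householderK. Qed.

Lemma householder_supported (T : eqType) (f : 'I_n -> T) i0 w :
  (forall i, f i != f i0 -> w 0 i = 0) -> supported f (householder w).
Proof.
move=> w0 i j fij; rewrite !mxE big_ord1 mxE.
have [ij|_] := eqVneq i j; first by rewrite ij eqxx in fij.
have [fi|fi] := eqVneq (f i) (f i0); last by rewrite w0 ?mul0r ?mulr0 ?subr0.
by rewrite (w0 j) ?mulr0 ?subr0 // -fi eq_sym.
Qed.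

End Householder.

(** The two vectors have the same length, so the reflection in the hyperplane orthogonal to their
    difference exchanges them. *)
Lemma householder_unit (R : rcfType) (n : nat) (y : 'rV[R]_n) (i : 'I_n) :
  let r := Num.sqrt (dotmx y y) in
  y *m householder (y - r *: delta_mx 0 i) = r *: delta_mx 0 i.
Proof.
set r := Num.sqrt _; cbv zeta.
set e := delta_mx 0 i; set w := y - r *: e.
have rr : dotmx y y = r ^+ 2 by rewrite sqr_sqrtr // dotmx_ge0.
have [w0|w0] := eqVneq w 0.
  rewrite w0 mul_householder scaler0 subr0; exact: subr0_eq.
have ww0 : dotmx w w != 0 by rewrite dotmx_eq0.
rewrite mul_householder.
have sE (z : 'rV[R]_n) : \sum_k z 0 k * e 0 k = z 0 i.
  rewrite (bigD1 i) //= big1 ?addr0 ?mxE ?eqxx ?mulr1 // => k ki.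
  by rewrite mxE (negbTE ki) andbF mulr0.
have yw : dotmx y w = r ^+ 2 - r * y 0 i.
  rewrite -rr !dotmx_sum -(sE y) mulr_sumr -sumrB; apply: eq_bigr => k _.
  by rewrite !mxE; ring.
have ww : dotmx w w = 2 * dotmx y w.
  have -> : dotmx w w = dotmx y w - r * w 0 i.
    rewrite !dotmx_sum -(sE w) mulr_sumr -sumrB; apply: eq_bigr => k _.
    by rewrite !mxE; ring.
  by rewrite yw /w !mxE !eqxx mulr1; ring.
by rewrite -ww divff // scale1r /w opprB addrC subrK.
Qed.

(** Deflation that respects the blocks: at stage [k] an eigenvector is found inside the block of
    index [k], among vectors vanishing on the first [k] coordinates, and a Householder reflection
    sends it to a multiple of the [k]-th basis vector. *)
Lemma supported_spectral (R : rcfType) (n : nat) (T : eqType) (f : 'I_n -> T)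
    (A : 'M[R]_n) (s : seq R) :
  A^T = A -> supported f A -> char_poly A = \prod_(a <- s) ('X - a%:P) ->
  exists (Q : 'M[R]_n) (l : 'rV[R]_n),
    [/\ orthogonal_mx Q, supported f Q & Q *m A *m Q^T = diag_mx l].
Proof.
move=> sA fA cA.
suff step k : (k <= n)%N ->
    exists Q : 'M[R]_n, [/\ orthogonal_mx Q, supported f Q &
    forall i j : 'I_n, (i < k)%N -> i != j -> (Q *m A *m Q^T) i j = 0].
  have [Q [oQ fQ dQ]] := step n (leqnn n).
  exists Q, (\row_i (Q *m A *m Q^T) i i); split=> //.
  apply/matrixP => i j; rewrite [RHS]mxE [X in X *+ _]mxE.
  have [<-|ij] := eqVneq i j.
    by rewrite mulr1n.
  by rewrite dQ.
elim: k => [_|k IH kn].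
  exists 1%:M; split=> //; [exact: orthogonal_mx1 | exact: supported1].
have [Q [oQ fQ dQ]] := IH (ltnW kn).
case: n f A sA fA cA kn {IH} Q oQ fQ dQ => // n f A sA fA cA kn Q oQ fQ dQ.
set B := Q *m A *m Q^T in dQ.
have sB : B^T = B by exact: conjmx_sym.
have BC i j : B i j = B j i by rewrite -{1}sB mxE.
have fB : supported f B.
  by apply: supportedM; [exact: supportedM | exact: supported_tr].
have BE (H : 'M[R]_n.+1) : H *m Q *m A *m (H *m Q)^T = H *m B *m H^T.
  by rewrite trmx_mul /B !mulmxA.
have B0 : horner_mx B (\prod_(a <- s) ('X - a%:P)) = 0.
  by rewrite -cA -(char_poly_conj A oQ) Cayley_Hamilton.
clearbody B.
(* The space [U] is stable under [B] because [B] is block diagonal and, by symmetry, its first [k]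
   columns as well as rows are already diagonal. *)
pose i0 := Ordinal kn.
pose U (y : 'rV[R]_n.+1) :=
  forall j : 'I_n.+1, (f j != f i0) || (j < k)%N -> y 0 j = 0.
have UB y a : U y -> U (y *m B - a *: y).
  move=> Uy j hj; rewrite !mxE Uy // mulr0 subr0 big1 // => m _.
  have [hm|] := boolP ((f m != f i0) || (m < k)%N).
    by rewrite Uy // mul0r.
  rewrite negb_or negbK -leqNgt => /andP[/eqP fm km].
  case/orP: hj => hj; first by rewrite fB ?mulr0 // fm eq_sym.
  rewrite BC dQ ?mulr0 //; rewrite -val_eqE /= ltn_eqF //.
  exact: leq_trans km.
have Ue : U (delta_mx 0 i0).
  move=> j hj; rewrite mxE eqxx /=; have [jE|//] := eqVneq j i0.
  by rewrite jE eqxx ltnn in hj.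
have e0 : delta_mx 0 i0 != 0 :> 'rV[R]_n.+1.
  by apply/eqP => /rowP/(_ i0)/eqP; rewrite !mxE !eqxx oner_eq0.
have [|a [y [Uy y0 yB]]] := @invariant_eigenvector _ _ B s U _ UB Ue e0.
  by rewrite B0 mulmx0.
pose r := Num.sqrt (dotmx y y).
have r0 : r != 0 by rewrite sqrtr_eq0 -ltNge lt_def dotmx_eq0 y0 dotmx_ge0.
pose w := y - r *: delta_mx 0 i0; pose H := householder w.
have yH : y *m H = r *: delta_mx 0 i0 by exact: householder_unit.
(* Since [w] lies in [U], the reflection acts within the block of [i0] and fixes the first [k] basis
   vectors. *)
have Uw : U w 
  by move=> j hj; have := Ue j hj; rewrite !mxE Uy // => ->; ring.
have eH : delta_mx 0 i0 *m H = r^-1 *: y.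
  apply: (scalerI r0); rewrite scalerA divff // scale1r scalemxAl -yH.
  by rewrite -mulmxA householderK mulmx1.
have fH : supported f H.
  by apply: householder_supported (i0) _ _ => i fi; rewrite Uw // fi.
have HT : H^T = H by exact: householder_sym.
exists (H *m Q); split.
- by apply: orthogonal_mxM => //; exact: householder_orthogonal.
- exact: supportedM.
rewrite BE HT.
suff rowH (i : 'I_n.+1) : (i < k.+1)%N ->
    exists c, delta_mx 0 i *m (H *m B *m H) = c *: (delta_mx 0 i : 'rV[R]_n.+1).
  move=> i j ik ij; have [c /rowP/(_ j)] := rowH _ ik.
  by rewrite -rowE !mxE eqxx eq_sym (negbTE ij) mulr0.
rewrite ltnS leq_eqVlt => /orP[/eqP ik|ik].
  have -> : i = i0 by apply: val_inj.
  exists a; rewrite !mulmxA eH -!scalemxAl yB -scalemxAl yH !scalerA.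
  by rewrite mulrAC mulVf // mul1r.
have eiH : delta_mx 0 i *m H = delta_mx 0 i :> 'rV[R]_n.+1.
  rewrite /H mul_householder (_ : dotmx (delta_mx 0 i) w = 0).
    by rewrite mulr0 mul0r scale0r subr0.
  rewrite dotmx_sum big1 // => j _; rewrite mxE eqxx /=.
  by case: eqVneq => [->|]; rewrite ?mul0r // Uw ?mulr0 // ik orbT.
exists (B i i); rewrite !mulmxA eiH.
suff -> : delta_mx 0 i *m B = B i i *: delta_mx 0 i :> 'rV[R]_n.+1
  by rewrite -scalemxAl eiH.
apply/rowP => j; rewrite -rowE !mxE eqxx /=.
have [->|ji] := eqVneq j i; first by rewrite mulr1.
by rewrite mulr0 dQ // eq_sym.
Qed.

(** * Entrywise bounds and correction of the diagonal *)

Definition entries_le (R : numDomainType) (m n : nat) (X : 'M[R]_(m, n)) (a : R)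
  : Prop := forall i j, `|X i j| <= a.

Section EntriesLe.
Variables (R : realFieldType) (n : nat).
Implicit Types (M X Y Q : 'M[R]_n) (a b c s : R).

Lemma entries_leD X Y a b :
  entries_le X a -> entries_le Y b -> entries_le (X + Y) (a + b).
Proof.
by move=> hX hY i j; rewrite mxE (le_trans (ler_normD _ _)) // lerD.
Qed.

Lemma entries_leM X Y a b :
  entries_le X a -> entries_le Y b -> entries_le (X *m Y) (n%:R * (a * b)).
Proof.
move=> hX hY i j; rewrite mxE (le_trans (ler_norm_sum _ _ _)) //.
rewrite -[n in n%:R]card_ord mulr_natl -sumr_const ler_sum // => k _.
by rewrite normrM ler_pM.
Qed.

Lemma entries_le_tr X a : entries_le X a -> entries_le X^T a.
Proof. by move=> hX i j; rewrite mxE. Qed.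

Lemma orthogonal_entries_le Q : orthogonal_mx Q -> entries_le Q 1.
Proof.
move=> oQ i j; rewrite -(@expr_le1 _ 2) //.
have <- : (Q *m Q^T) i i = 1 by rewrite oQ mxE eqxx.
rewrite [leRHS]mxE (bigD1 j) //= mxE real_normK ?num_real // -expr2 lerDl.
by rewrite sumr_ge0 // => k _; rewrite mxE -expr2 sqr_ge0.
Qed.

Lemma conjmx_entries_le Q X a : orthogonal_mx Q -> entries_le X a ->
  entries_le (Q *m X *m Q^T) (n%:R ^+ 2 * a).
Proof.
move=> oQ hX; have hQ := orthogonal_entries_le oQ.
have := entries_leM (entries_leM hQ hX) (entries_le_tr hQ).
by rewrite mul1r mulr1 mulrA -expr2.
Qed.

Lemma conjmx_diff_entries_le Q M a b : orthogonal_mx Q ->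
  entries_le (Q - 1%:M) a -> entries_le M b ->
  entries_le (Q *m M *m Q^T - M) ((n%:R ^+ 2 + n%:R) * (a * b)).
Proof.
move=> oQ hQ1 hM; have hQ := orthogonal_entries_le oQ.
have -> : Q *m M *m Q^T - M = (Q - 1%:M) *m M *m Q^T + M *m (Q - 1%:M)^T.
  rewrite !mulmxBl mul1mx linearB /= trmx1 mulmxBr mulmx1.
  by rewrite addrA subrK.
have h1 := entries_leM (entries_leM hQ1 hM) (entries_le_tr hQ).
have h2 := entries_leM hM (entries_le_tr hQ1).
have -> : (n%:R ^+ 2 + n%:R) * (a * b) =
    n%:R * (n%:R * (a * b) * 1) + n%:R * (b * a) by ring.
exact: entries_leD.
Qed.

Lemma givens_entries_le (i j : 'I_n) c s : 0 <= c -> c ^+ 2 + s ^+ 2 = 1 ->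
  entries_le (givens i j c s - 1%:M) (4 * `|s|).
Proof.
move=> c0 cs1 a b.
have s1 : `|s| <= 1.
  rewrite -(@expr_le1 _ 2) // real_normK ?num_real //.
  by rewrite -cs1 lerDr sqr_ge0.
have c1 : c <= 1.
  by rewrite -(@expr_le1 _ 2) // -cs1 lerDl sqr_ge0.
(* From [0 <= c <= 1]: [1 - c <= 1 - c ^+ 2 = s ^+ 2 <= |s|]. *)
have hc : `|c - 1| <= `|s|.
  rewrite distrC ger0_norm ?subr_ge0 //.
  have : `|s| ^+ 2 = s ^+ 2 by rewrite real_normK ?num_real.
  have := normr_ge0 s; nra.
have dE (x y : 'I_n) : `|(delta_mx x y : 'M[R]_n) a b| <= 1.
  by rewrite mxE; case: (_ && _); rewrite ?normr1 ?normr0.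
rewrite /givens.
rewrite [X in `|X|](_ : _ = (c - 1) * (delta_mx i i : 'M[R]_n) a b
   + (c - 1) * (delta_mx j j : 'M[R]_n) a b
   + s * (delta_mx i j : 'M[R]_n) a b - s * (delta_mx j i : 'M[R]_n) a b);
  last by rewrite !mxE; ring.
have hcd x y : `|(c - 1) * (delta_mx x y : 'M[R]_n) a b| <= `|s|.
  by rewrite normrM -[leRHS]mulr1 ler_pM.
have hsd x y : `|s * (delta_mx x y : 'M[R]_n) a b| <= `|s|.
  by rewrite normrM -[leRHS]mulr1 ler_pM.
have -> : 4 * `|s| = `|s| + `|s| + `|s| + `|s| by ring.
rewrite (le_trans (ler_normB _ _)) // lerD // (le_trans (ler_normD _ _)) //.
by rewrite lerD // (le_trans (ler_normD _ _)) // lerD.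
Qed.

End EntriesLe.

(** For symmetric [A] these are the unions of connected components of its graph, and a hitting set
    is one that meets every component. *)
Definition closed_set (R : pzRingType) (n : nat) (A : 'M[R]_n)
    (S : {set 'I_n}) :=
  [forall i in S, forall j in ~: S, A i j == 0].

Definition hitting_set (R : pzRingType) (n : nat) (A : 'M[R]_n)
    (T : {set 'I_n}) :=
  [forall S : {set 'I_n},
    closed_set A S ==> (S != finset.set0) ==> ~~ [disjoint S & T]].

(* Vertices outside T are processed from the leaves inwards: the rotation in
   the plane of v and a neighbour p in T corrects the entry at v, and neither v
   nor any vertex corrected earlier is touched again. *)
Lemma diag_correction (R : rcfType) (n : nat) (TT : eqType) (f : 'I_n -> TT)
    (A : 'M[R]_n) (T : {set 'I_n}) :
  A^T = A -> supported f A -> hitting_set A T ->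
  exists C d : R, [/\ 0 <= C, 0 < d & forall (M : 'M[R]_n) (h : R),
    M^T = M -> 0 <= h <= d -> entries_le (M - A) h ->
    exists Q : 'M[R]_n, [/\ orthogonal_mx Q, supported f Q,
      entries_le (Q *m M *m Q^T - A) (C * h) &
      forall v, v \notin T -> (Q *m M *m Q^T) v v = A v v]].
Proof.
move=> sA fA; have [N] := ubnP #|~: T|.
elim: N T => // N IH T; rewrite ltnS => cT hT.
have [->|TnT] := eqVneq T [set: 'I_n].
  exists 1, 1; split=> // M h sM _ MA.
  exists 1%:M; rewrite trmx1 mulmx1 mul1mx mul1r; split=> //.
  - exact: orthogonal_mx1.
  - exact: supported1.
  - by move=> v; rewrite inE.
(* The complement of [T] is nonempty and misses [T], so it is not closed: some edge leaves it. *)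
have [p [v [pT vT Avp]]] : exists p v, [/\ p \in T, v \notin T & A v p != 0].
  have nc : ~~ closed_set A (~: T).
    apply/negP => cl; move/forallP/(_ (~: T)): hT; rewrite cl.
    rewrite -finset.setCT (inj_eq (@finset.setC_inj _)) TnT /= -setI_eq0.
    by rewrite finset.setIC finset.setICr eqxx.
  move: nc; rewrite negb_forall => /existsP[v]; rewrite negb_imply inE.
  case/andP => vT; rewrite negb_forall => /existsP[p]; rewrite negb_imply.
  by rewrite finset.setCK => /andP[pT Avp]; exists p, v.
have vp : v != p by apply: contraNneq vT => ->.
have hT' : hitting_set A (v |: T).
  apply/forallP => S; apply/implyP => cS; apply/implyP => S0.
  move/forallP/(_ S): hT; rewrite cS S0 /=; apply: contra.
  by apply: disjointWr; apply: finset.subsetUr.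
have [|C0 [d0 [C00 d00 IH0]]] := IH _ _ hT'.
  rewrite finset.setCU finset.setIC -finset.setDE; apply: leq_trans cT.
  by rewrite [X in (_ < X)%N](cardsD1 v) inE vT.
pose b := `|A v p|; have b0 : 0 < b by rewrite normr_gt0.
pose K := 1 + \sum_i \sum_j `|A i j|.
have AK i j : `|A i j| + 1 <= K.
  rewrite addrC lerD2l (bigD1 i) //= (bigD1 j) //= -addrA lerDl addr_ge0 //.
    by rewrite sumr_ge0.
  by rewrite sumr_ge0 // => k _; rewrite sumr_ge0.
have K0 : 0 < K by apply: lt_le_trans (AK v v); rewrite ltr_wpDl.
(* With [C0 * h <= m], the bound 1 keeps the entries of [M1] below [K], [b / 2] keeps [M1 v p] away
   from zero, and [b ^+ 2 / (8 * K)] makes the discriminant of the rotation nonnegative. *)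
pose m := Num.min 1 (Num.min (b / 2) (b ^+ 2 / (8 * K))).
have m0 : 0 < m by rewrite !lt_min ltr01 !divr_gt0 ?exprn_gt0 ?mulr_gt0.
(* The second term is the effect of the rotation: its sine is at most [2 * C0 / b * h], it differs
   from the identity by at most four times that, and it acts on entries bounded by [K]. *)
pose C := C0 + (n%:R ^+ 2 + n%:R) * (4 * (2 * C0 / b) * K).
exists C, (Num.min d0 (m / (C0 + 1))).
have C1 : 0 < C0 + 1 by rewrite ltr_wpDl.
split.
- rewrite addr_ge0 // mulr_ge0 ?addr_ge0 ?exprn_ge0 ?ler0n //.
  by rewrite !mulr_ge0 ?invr_ge0 // ltW.
- by rewrite lt_min d00 divr_gt0.
move=> M h sM /andP[h0]; rewrite le_min => /andP[hd hm] MA.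
have [|Q0 [oQ0 fQ0]] := IH0 M h sM _ MA; first by rewrite h0.
set M1 := Q0 *m M *m Q0^T => M1A dM1.
have sM1 : M1^T = M1 by exact: conjmx_sym.
have Ch : C0 * h <= m.
  have : h * (C0 + 1) <= m by rewrite -ler_pdivlMr.
  by rewrite mulrDr mulr1 mulrC; apply: le_trans; rewrite lerDl.
have [Ch1 Chb ChK] : [/\ C0 * h <= 1, C0 * h <= b / 2
    & C0 * h * (8 * K) <= b ^+ 2].
  move: Ch; rewrite !le_min => /and3P[-> ->].
  by rewrite ler_pdivlMr ?mulr_gt0.
have M1AE i j : `|M1 i j - A i j| <= C0 * h.
  by have := M1A i j; rewrite mxE [X in _ + X]mxE.
have M1K : entries_le M1 K.
  move=> i j; rewrite -(subrK (A i j) (M1 i j)) addrC.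
  rewrite (le_trans (ler_normD _ _)) // (le_trans _ (AK i j)) // lerD2l.
  by apply: le_trans Ch1.
pose t := A v v - M1 v v.
have tC : `|t| <= C0 * h by rewrite distrC.
have bM1 : b / 2 <= `|M1 v p|.
  have hv := M1AE v p.
  have := ler_normD (M1 v p) (A v p - M1 v p).
  rewrite subrKC distrC -/b; lra.
have disc : 0 <= M1 v p ^+ 2 + t * (M1 p p - M1 v v - t).
  have -> : M1 p p - M1 v v - t = M1 p p - A v v by rewrite /t; ring.
  have hg : `|M1 p p - A v v| <= K + K.
    apply: le_trans (ler_normB _ _) _; apply: lerD => //.
    by apply: le_trans (AK v v); rewrite lerDl.
  have htg : `|t * (M1 p p - A v v)| <= C0 * h * (K + K).
    by rewrite normrM ler_pM.
  have hb2 : (b / 2) ^+ 2 <= M1 v p ^+ 2.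
    rewrite -[leRHS]real_normK ?num_real // ler_pXn2r ?nnegrE //.
    by rewrite divr_ge0 // ltW.
  move: htg; rewrite ler_norml => /andP[htg _].
  move: ChK hb2; rewrite exprMn; lra.
have [c [s [cs1 cst c0 hs]]] := rotation_angle disc.
have sC : `|s| <= 2 * C0 / b * h.
  have : b / 2 * `|s| <= C0 * h.
    by apply: le_trans tC; apply: le_trans hs; rewrite ler_wpM2r.
  move=> sb; rewrite [leRHS]mulrAC ler_pdivlMr //; lra.
pose G := givens v p c s.
have oG : orthogonal_mx G by exact: givens_orthogonal.
(* An edge joins indices with equal labels, so the rotation stays block diagonal. *)
have fvp : f v = f p by apply: contraNeq Avp => /fA ->.
have GQ : (G *m Q0) *m M *m (G *m Q0)^T = G *m M1 *m G^T.
  by rewrite trmx_mul /M1 !mulmxA.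
exists (G *m Q0); rewrite GQ; split.
- exact: orthogonal_mxM.
- by apply: supportedM => //; exact: givens_supported.
- have -> : G *m M1 *m G^T - A = (M1 - A) + (G *m M1 *m G^T - M1).
    by rewrite [RHS]addrC subrKA.
  rewrite mulrDl; apply: entries_leD => // i j.
  have := conjmx_diff_entries_le oG (givens_entries_le v p c0 cs1) M1K i j.
  move/le_trans; apply.
  rewrite -[leRHS]mulrA ler_wpM2l ?addr_ge0 ?exprn_ge0 //.
  by rewrite [leRHS]mulrAC ler_wpM2r ?(ltW K0) // -[leRHS]mulrA ler_wpM2l.
move=> w wT; have [->|wv] := eqVneq w v.
  by rewrite givens_diag_pivot // cst /t addrC subrK.
have wp : w != p by apply: contraNneq wT => ->.
by rewrite givens_diag_other // dM1 // !inE negb_or wv.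
Qed.

(** * Majorization *)

Section SortUp.
Variables (R : realType) (n : nat).
Implicit Types (x l d : 'rV[R]_n) (S : {set 'I_n}).

Lemma sort_up_perm x : exists s : 'S_n, forall i, sort_up x 0 i = x 0 (s i).
Proof.
pose t := [tuple x 0 j | j < n].
have /tuple_permP[s sE] : perm_eq (sort <=%R t) t by rewrite perm_sort.
exists s => i.
have tE : t = [seq x 0 j | j : 'I_n] :> seq R by [].
by rewrite mxE -tE sE -tnth_nth !tnth_mktuple.
Qed.

Lemma sort_up_mono x (i j : 'I_n) :
  (i <= j)%N -> sort_up x 0 i <= sort_up x 0 j.
Proof.
move=> ij; rewrite !mxE.
have sz : size (sort <=%R [seq x 0 k | k : 'I_n]) = n.
  by rewrite size_sort size_map size_enum_ord.
by apply: (sorted_leq_nth le_trans le_refl) => //;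
  rewrite ?inE ?sz // sort_sorted //; exact: le_total.
Qed.

Lemma sort_up_permute x (s : 'S_n) : sort_up (\row_i x 0 (s i)) = sort_up x.
Proof.
apply/rowP => i; rewrite !mxE; congr (nth 0 _ i).
apply/perm_sort_leP.
have -> : [seq (\row_k x 0 (s k)) 0 j | j : 'I_n] =
    [tuple tnth [tuple x 0 k | k < n] (s j) | j < n].
  by apply: eq_image => // j; rewrite mxE tnth_mktuple.
by apply/(@tuple_permP _ _ _ [tuple x 0 k | k < n]); exists s.
Qed.

Lemma card_prefix m : (m <= n)%N -> #|[pred i : 'I_n | (i < m)%N]| = m.
Proof.
move=> mn; rewrite -sum1_card -(big_ord_widen n (fun=> 1%N) mn).
by rewrite sum1_card card_ord.
Qed.

(** Both index sets have the same size. Relative to the threshold [th], the last value of the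
    prefix, indices in the prefix alone contribute at most zero and indices in [S] alone at least
    zero. *)
Lemma prefix_sum_sorted_le (y : 'I_n -> R) S :
  (forall i j : 'I_n, (i <= j)%N -> y i <= y j) ->
  \sum_(i < n | (i < #|S|)%N) y i <= \sum_(i in S) y i.
Proof.
move=> ymono; set k := #|S|.
have [S0|[i0 i0S]] := finset.set_0Vmem S.
  rewrite S0 finset.big_set0 big_pred0 // => i; by rewrite /k S0 finset.cards0.
have k0 : (0 < k)%N by rewrite card_gt0; apply/finset.set0Pn; exists i0.
have kn : (k.-1 < n)%N by rewrite prednK // -[n in (_ <= n)%N]card_ord max_card.
pose th := y (Ordinal kn).
have cardk : \sum_(i < n | (i < k)%N) th = \sum_(i in S) th.
  rewrite !sumr_const; congr (_ *+ _); apply: card_prefix.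
  by rewrite -[n in (_ <= n)%N]card_ord max_card.
rewrite -(lerD2r (- \sum_(i in S) th)) -{1}cardk -!sumrB.
rewrite (bigID (mem S)) [leRHS](bigID (fun i : 'I_n => (i < k)%N)) /=.
rewrite (eq_bigl (fun i => (i \in S) && (i < k)%N)); last first.
  by move=> i; rewrite andbC.
rewrite lerD2l; apply: (@le_trans _ _ 0).
  apply: sumr_le0 => i /andP[ik _]; rewrite subr_le0 ymono //=.
  by rewrite -ltnS prednK.
apply: sumr_ge0 => i /andP[_]; rewrite -leqNgt => ki.
by rewrite subr_ge0 ymono //= (leq_trans (leq_pred _)).
Qed.

Lemma sort_up_sum x : \sum_i sort_up x 0 i = \sum_i x 0 i.
Proof.
have [s sE] := sort_up_perm x; rewrite (eq_bigr _ (fun i _ => sE i)).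
by rewrite [RHS](reindex_inj (@perm_inj _ s)).
Qed.

Lemma sort_up_prefix_le x S :
  \sum_(i < n | (i < #|S|)%N) sort_up x 0 i <= \sum_(i in S) x 0 i.
Proof.
have [s sE] := sort_up_perm x.
have -> : \sum_(i in S) x 0 i = \sum_(i in s @^-1: S) sort_up x 0 i.
  rewrite (reindex_inj (@perm_inj _ s)) /=.
  by apply: eq_big => i; rewrite ?inE ?sE.
have -> : #|S| = #|s @^-1: S| by rewrite (card_preimset S (@perm_inj _ s)).
exact/prefix_sum_sorted_le/sort_up_mono.
Qed.

End SortUp.

Section Majorization.
Variables (R : realType) (n : nat).
Implicit Types (l d x y c : 'rV[R]_n).

Lemma majorized_sum x y : majorized x y -> \sum_i x 0 i = \sum_i y 0 i.
Proof. by case=> _; rewrite !sort_up_sum. Qed.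

Lemma majorized_prefix x y m : majorized x y ->
  \sum_(i < n | (i < m)%N) sort_up x 0 i <=
  \sum_(i < n | (i < m)%N) sort_up y 0 i.
Proof.
case=> hlt heq; have [m0|m0] := posnP m; first by rewrite m0 !big_pred0.
have [mn|nm] := ltnP m n; first by rewrite hlt // m0.
have h (i : 'I_n) : (i < m)%N = true by rewrite (leq_trans (ltn_ord i)).
by rewrite !(eq_bigl _ _ h) heq.
Qed.

(** A sorted prefix sum of [y] is the sum over some subset of that size, so [y] need not be sorted;
    this suits points of a segment, whose order is unknown. *)
Lemma majorized_of_subsets x y : \sum_i x 0 i = \sum_i y 0 i ->
  (forall S : {set 'I_n},
    \sum_(i < n | (i < #|S|)%N) sort_up x 0 i <= \sum_(i in S) y 0 i) ->
  majorized x y.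
Proof.
move=> xy hS; split=> [k /andP[_ kn]|]; last by rewrite !sort_up_sum.
have [s sE] := sort_up_perm y.
pose S : {set 'I_n} := s @: [set i : 'I_n | (i < k)%N].
have cS : #|S| = k.
  rewrite card_imset; last exact: perm_inj.
  by rewrite cardsE card_prefix // ltnW.
have := hS S; rewrite cS => /le_trans; apply.
rewrite (eq_bigr _ (fun i _ => sE i)) big_imset /=; last first.
  by move=> ? ? _ _ /perm_inj.
by rewrite le_eqVlt; apply/orP; left; apply/eqP/eq_bigl => i; rewrite inE.
Qed.

Lemma majorized_permute x y (s : 'S_n) :
  majorized x y -> majorized (\row_i x 0 (s i)) y.
Proof. by rewrite /majorized sort_up_permute. Qed.

(* On a subset where d has a smaller sum than l, the bound for d suffices;
   where it has a larger sum, moving towards d by a multiple of e compensates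
   the perturbation of l. *)
Lemma majorized_segment l d : \sum_i l 0 i = \sum_i d 0 i ->
  exists K : R, 0 <= K /\ forall e x, 0 <= e -> K * e <= 1 ->
    (forall i, `|l 0 i - x 0 i| <= e) -> majorized x d ->
    majorized x (l + (K * e) *: (d - l)).
Proof.
move=> ld.
pose g (S : {set 'I_n}) := \sum_(i in S) d 0 i - \sum_(i in S) l 0 i.
(* [K] dominates every [n / |g S|]; subsets with [g S = 0] contribute zero because the inverse of
   zero is zero. *)
pose K := \sum_(S : {set 'I_n}) n%:R / `|g S|.
have K0 : 0 <= K by rewrite sumr_ge0 // => S _; rewrite divr_ge0.
exists K; split=> // e x e0 Ke1 lx xd.
have cE (S : {set 'I_n}) : \sum_(i in S) (l + (K * e) *: (d - l)) 0 i =
    \sum_(i in S) l 0 i + K * e * g S.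
  rewrite /g -sumrB mulr_sumr -big_split /=; apply: eq_bigr => i _.
  by rewrite !mxE.
have sumT y : \sum_i y 0 i = \sum_(i in [set: 'I_n]) y 0 i.
  by apply: eq_bigl => i; rewrite inE.
apply: majorized_of_subsets.
  rewrite [RHS]sumT cE /g -!sumT ld subrr mulr0 addr0.
  exact: majorized_sum.
move=> S; rewrite cE.
have hd : \sum_(i < n | (i < #|S|)%N) sort_up x 0 i <= \sum_(i in S) d 0 i.
  exact: le_trans (majorized_prefix _ xd) (sort_up_prefix_le _ _).
have [gS|gS] := leP (g S) 0.
  apply: le_trans hd _.
  have : 0 <= (K * e - 1) * g S by rewrite mulr_le0 // subr_le0.
  rewrite {1}/g; rewrite /g; lra.
have hl : \sum_(i in S) x 0 i <= \sum_(i in S) l 0 i + n%:R * e.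
  rewrite -lerBlDl -sumrB.
  apply: (@le_trans _ _ (\sum_(i in S) e)).
    apply: ler_sum => i _; have := lx i; rewrite ler_norml; lra.
  rewrite sumr_const -[leLHS]mulr_natl ler_wpM2r // ler_nat.
  by rewrite -[n in (_ <= n)%N]card_ord max_card.
apply: le_trans (sort_up_prefix_le _ _) _; apply: le_trans hl _.
rewrite lerD2l mulrAC ler_wpM2r // -ler_pdivrMr // -[X in _ / X]gtr0_norm //.
rewrite /K (bigD1 S) //= lerDl sumr_ge0 // => S' _; by rewrite divr_ge0.
Qed.

(** The sorted diagonal is obtained first; conjugation by a permutation matrix then restores the
    order of [c]. *)
Lemma schur_horn x c : majorized x c ->
  exists P : 'M[R]_n, orthogonal_mx P /\
    forall i, (P *m diag_mx (sort_up x) *m P^T) i i = c 0 i.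
Proof.
move=> xc; have [s sE] := sort_up_perm c.
have dE i : (diag_mx (sort_up x)) i i = sort_up x 0 i.
  by rewrite [LHS]mxE eqxx mulr1n.
have [||m||P [oP dP]] := @schur_horn_prefix R n (fun i => sort_up c 0 i)
    (diag_mx (sort_up x)).
- exact: tr_diag_mx.
- by move=> i j; exact: sort_up_mono.
- by rewrite (eq_bigr _ (fun i _ => dE i)) majorized_prefix.
- by rewrite (eq_bigr _ (fun i _ => dE i)) !sort_up_sum; exact: majorized_sum.
pose W : 'M[R]_n := perm_mx (s^-1)%g.
have WT : W^T = perm_mx s by rewrite tr_perm_mx invgK.
exists (W *m P); split.
  apply: orthogonal_mxM => //; rewrite /orthogonal_mx WT.
  by rewrite -perm_mxM mulVg perm_mx1.
move=> i; set X := P *m _ *m _ in dP.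
have -> : W *m P *m diag_mx (sort_up x) *m (W *m P)^T = W *m X *m W^T.
  by rewrite trmx_mul /X !mulmxA.
have -> : W^T = perm_mx (s^-1)^-1%g by rewrite WT invgK.
by rewrite -row_permE -col_permE [LHS]mxE [LHS]mxE dP sE permKV.
Qed.

End Majorization.

(** * Closed sets and the main estimate *)

(** By minimality, removing [v] leaves some closed set unhit, and this set meets [T] only in [v].
    Such a [v] is the root whose diagonal entry will be recovered from a trace. *)
Lemma minimal_hitting_set (R : pzRingType) (n : nat) (A : 'M[R]_n) :
  exists T, hitting_set A T /\ forall v, v \in T ->
    exists S : {set 'I_n}, [/\ closed_set A S, v \in S &
      forall w, w \in S -> w != v -> w \notin T].
Proof.
have hT : hitting_set A [set: 'I_n].
  apply/forallP => S; apply/implyP => _; apply/implyP => S0.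
  by rewrite -finset.setI_eq0 finset.setIT.
have [T /minsetP[hitT minT] _] := minset_exists hT.
exists T; split=> // v vT.
have : ~~ hitting_set A (T :\ v).
  apply/negP => /minT /(_ (finset.subD1set _ _)) TE.
  by move: vT; rewrite -TE !inE eqxx.
rewrite negb_forall => /existsP[S]; rewrite negb_imply.
case/andP => cS; rewrite negb_imply => /andP[S0]; rewrite negbK => dS; exists S.
have SnT w : w \in S -> w != v -> w \notin T.
  move=> wS wv; move: (disjointFr dS wS); rewrite !inE wv /=.
  by move=> ->.
split=> //; apply: contraT => vS.
move/forallP/(_ S): hitT; rewrite cS S0 /= => /negP[].
rewrite disjoint_subset; apply/fintype.subsetP => w wS; rewrite inE SnT //.
by apply: contraNneq vS => <-.
Qed.

(* Two vertices have the same label iff they are in the same connected component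
   of the graph of A. *)
Definition closed_label (R : pzRingType) (n : nat) (A : 'M[R]_n) (i : 'I_n) :
  {set {set 'I_n}} := [set S | closed_set A S && (i \in S)].

Lemma closed_labelP (R : pzRingType) (n : nat) (A : 'M[R]_n) (S : {set 'I_n})
    (i j : 'I_n) :
  closed_set A S -> closed_label A i = closed_label A j ->
  (i \in S) = (j \in S).
Proof. by move=> cS /setP/(_ S); rewrite !inE cS. Qed.

Lemma closed_label_supported (R : pzRingType) (n : nat) (A : 'M[R]_n) :
  A^T = A -> supported (closed_label A) A.
Proof.
move=> sA i j; apply: contraNeq => Aij; apply/eqP/setP => S; rewrite !inE.
have [cS|//] := boolP (closed_set A S).
have out k m : k \in S -> m \notin S -> A k m = 0.
  move=> kS mS; have /forallP/(_ k)/implyP/(_ kS) := cS.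
  by move/forallP/(_ m); rewrite inE mS => /eqP.
have Aji : A j i != 0 by rewrite -sA mxE.
apply/idP/idP => [iS|jS]; apply: contraT => nS.
  by rewrite out ?eqxx in Aij.
by rewrite out ?eqxx in Aji.
Qed.

Lemma perm_of_prod_XsubC (R : fieldType) (n : nat) (x y : 'rV[R]_n) :
  \prod_(i < n) ('X - (x 0 i)%:P) = \prod_(i < n) ('X - (y 0 i)%:P) ->
  exists s : 'S_n, forall i, x 0 i = y 0 (s i).
Proof.
pose t (z : 'rV[R]_n) := [tuple z 0 i | i < n].
have tE (z : 'rV[R]_n) :
    \prod_(i < n) ('X - (z 0 i)%:P) = \prod_(a <- t z) ('X - a%:P).
  by rewrite big_tuple; apply: eq_bigr => i _; rewrite tnth_mktuple.
rewrite !tE => /prod_XsubC_eq /tuple_permP[s sE]; exists s => i.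
have /(congr1 (fun u => tnth u i)) : t x = [tuple tnth (t y) (s j) | j < n].
  exact: val_inj.
by rewrite !tnth_mktuple.
Qed.

(* Only the diagonal of M enters the cross term of |M - diag l|^2, so a diagonal
   close to l and a spectrum close to l already force M close to diag l. *)
Lemma conj_diag_dist (R : comUnitRingType) (n : nat) (P : 'M[R]_n)
    (y l : 'rV[R]_n) : orthogonal_mx P ->
  let M := P *m diag_mx y *m P^T in
  \sum_i \sum_j (M - diag_mx l) i j * (M - diag_mx l) i j =
  \sum_i (y 0 i ^+ 2 - M i i * l 0 i *+ 2 + l 0 i ^+ 2).
Proof.
move=> oP M; rewrite -mxtrace_mul_tr.
have sM : M^T = M by apply: conjmx_sym; rewrite tr_diag_mx.
have DD (z : 'rV[R]_n) : \tr (diag_mx z *m diag_mx z) = \sum_i z 0 i ^+ 2.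
  rewrite mulmx_diag mxtrace_diag.
  by apply: eq_bigr => i _; rewrite !mxE expr2.
have MM : \tr (M *m M) = \sum_i y 0 i ^+ 2.
  have -> : M *m M = P *m (diag_mx y *m diag_mx y) *m P^T.
    rewrite /M !mulmxA -(mulmxA _ P^T P) (orthogonal_mx_tr_mul oP) mulmx1.
    by [].
  by rewrite mxtrace_mulC (mulmxA P^T) (orthogonal_mx_tr_mul oP) mul1mx DD.
rewrite linearB /= sM tr_diag_mx mulmxBl !mulmxBr !linearB /= MM.
rewrite (mxtrace_mulC (diag_mx l)) DD.
have -> : \tr (M *m diag_mx l) = \sum_i M i i * l 0 i.
  by apply: eq_bigr => i _; rewrite mul_mx_diag [LHS]mxE.
clearbody M; rewrite !big_split /= sumrN sumrMnl.
ring.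
Qed.

Lemma schur_horn_near_diag (R : realType) (n : nat) (l d : 'rV[R]_n) :
  \sum_i l 0 i = \sum_i d 0 i ->
  exists H r : R, [/\ 0 <= H, 0 < r & forall e (x : 'rV[R]_n), 0 <= e <= r ->
    (forall i, `|l 0 i - x 0 i| <= e) -> majorized x d ->
    exists (P : 'M[R]_n) (t : R), let M := P *m diag_mx (sort_up x) *m P^T in
      [/\ orthogonal_mx P, entries_le (M - diag_mx l) (H * Num.sqrt e)
        & forall i, M i i = l 0 i + t * (d 0 i - l 0 i)]].
Proof.
move=> ld; have [K [K0 maj]] := majorized_segment ld.
(* After expansion each term is [x ^+ 2 - l ^+ 2], at most [(2 * |l| + 1) * e] when [e <= 1], minus
   [2 * K * e * (d - l) * l]. *)
pose C := \sum_i (2 * `|l 0 i| + 1 + 2 * (K * `|(d 0 i - l 0 i) * l 0 i|)).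
have C0 : 0 <= C.
  by rewrite sumr_ge0 // => i _; rewrite !addr_ge0 ?mulr_ge0.
have K1 : 0 < K + 1 by rewrite ltr_wpDl.
exists (Num.sqrt C), (Num.min 1 (K + 1)^-1); split.
- exact: sqrtr_ge0.
- by rewrite lt_min ltr01 invr_gt0.
move=> e x /andP[e0]; rewrite le_min => /andP[e1 eK] lx xd.
have Ke1 : K * e <= 1.
  have : e * (K + 1) <= 1 by rewrite -ler_pdivlMr ?div1r.
  lra.
have [P [oP dP]] := schur_horn (maj e x e0 Ke1 lx xd).
exists P, (K * e) => M.
have dM i : M i i = l 0 i + K * e * (d 0 i - l 0 i) by rewrite dP !mxE.
split=> // i j.
rewrite -sqrtrM // -[leLHS]ger0_norm // -sqrtr_sqr ler_wsqrtr //.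
rewrite real_normK ?num_real // expr2.
apply: (@le_trans _ _
  (\sum_i \sum_j (M - diag_mx l) i j * (M - diag_mx l) i j)).
  rewrite (bigD1 i) //= (bigD1 j) //= -addrA lerDl addr_ge0 ?sumr_ge0 // => k _.
    by rewrite -expr2 sqr_ge0.
  by rewrite sumr_ge0 // => m _; rewrite -expr2 sqr_ge0.
rewrite conj_diag_dist // -/M.
have [s sE] := sort_up_perm x.
(* Only the sum of squares of the spectrum occurs, so [x] may be put back in the order that pairs it
   with [l]. *)
have -> : \sum_k (sort_up x 0 k ^+ 2 - M k k * l 0 k *+ 2 + l 0 k ^+ 2) =
    \sum_k (x 0 k ^+ 2 - M k k * l 0 k *+ 2 + l 0 k ^+ 2).
  rewrite !big_split /=; congr (_ + _ + _).
  rewrite [RHS](reindex_inj (@perm_inj _ s)) /=.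
  by apply: eq_bigr => k _; rewrite sE.
rewrite /C mulr_suml; apply: ler_sum => k _; rewrite dM.
set u := l 0 k; set v := x 0 k; set w := d 0 k.
have huv : v ^+ 2 - u ^+ 2 <= (2 * `|u| + 1) * e.
  have h : `|v - u| <= e by rewrite distrC lx.
  have -> : v ^+ 2 - u ^+ 2 = (v - u) * (2 * u + (v - u)) by ring.
  apply: le_trans (ler_norm _) _; rewrite normrM mulrC ler_pM //.
  apply: le_trans (ler_normD _ _) _; rewrite lerD ?(le_trans h) //.
  by rewrite normrM ger0_norm.
have hw : - ((w - u) * u) <= `|(w - u) * u|.
  by rewrite -normrN ler_norm.
have := ler_wpM2l (mulr_ge0 K0 e0) hw.
move: huv; set a := `|(w - u) * u|; set b := `|u|; lra.
Qed.

(** Fixing the constants before [e] and [x] makes the estimate uniform, so that any perturbed family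
    can be substituted. *)
Lemma schur_horn_perturbation (R : realType) (n : nat) (A : 'M[R]_n)
    (lam : 'rV[R]_n) : A^T = A -> has_eigenvalues A lam ->
  exists C r : R, [/\ 0 <= C, 0 < r & forall e (x : 'rV[R]_n), 0 <= e <= r ->
    (forall i, `|lam 0 i - x 0 i| <= e) -> majorized x (diag_entries A) ->
    exists B : 'M[R]_n, [/\ B^T = B, has_eigenvalues B x,
      diag_entries B = diag_entries A &
      entries_le (B - A) (C * Num.sqrt e)]].
Proof.
move=> sA eA; have fA := closed_label_supported sA.
have [|Q [l [oQ fQ QAQ]]] :=
    @supported_spectral R n _ _ A [seq lam 0 i | i <- index_enum 'I_n] sA fA.
  by rewrite big_map eA.
have oQT := orthogonal_mx_tr_mul oQ.
have AE : A = Q^T *m diag_mx l *m Q.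
  by rewrite -QAQ !mulmxA oQT mul1mx -mulmxA oQT mulmx1.
have [s sE] : exists s : 'S_n, forall i, l 0 i = lam 0 (s i).
  apply: perm_of_prod_XsubC.
  by rewrite -char_poly_diag -QAQ char_poly_conj // eA.
have lE i : (diag_mx l) i i = l 0 i by rewrite [LHS]mxE eqxx mulr1n.
set d := diag_entries A; have dE i : d 0 i = A i i by rewrite mxE.
have sum_ld (S : {set 'I_n}) : closed_set A S ->
    \sum_(i in S) l 0 i = \sum_(i in S) d 0 i.
  move=> cS; rewrite (eq_bigr _ (fun i _ => esym (lE i))) -QAQ.
  rewrite (sum_diag_conj A oQT fQ) => [|i j]; last exact: closed_labelP.
  by apply: eq_bigr => i _; rewrite dE.
have ld : \sum_i l 0 i = \sum_i d 0 i.
  have cT : closed_set A [set: 'I_n].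
    apply/forallP => i; apply/implyP => _; apply/forallP => j.
    by rewrite !inE.
  have h (i : 'I_n) : true = (i \in [set: 'I_n]) by rewrite inE.
  by rewrite !(eq_bigl _ _ h) sum_ld.
have [H [r1 [H0 r10 near]]] := schur_horn_near_diag ld.
have [T [hT minT]] := minimal_hitting_set A.
have [C [r2 [C0 r20 corr]]] := diag_correction sA fA hT.
pose H' := n%:R ^+ 2 * H.
have H'0 : 0 <= H' by rewrite mulr_ge0 ?exprn_ge0.
have H1 : 0 < H' + 1 by rewrite ltr_wpDl.
(* The second bound on [e] gives [H' * Num.sqrt e <= r2], the range in which the diagonal can be
   corrected. *)
exists (C * H'), (Num.min r1 ((r2 / (H' + 1)) ^+ 2)); split.
- exact: mulr_ge0.
- by rewrite lt_min r10 exprn_gt0 ?divr_gt0.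
move=> e x /andP[e0]; rewrite le_min => /andP[er1 er2] lx xd.
(* The diagonalization lists the eigenvalues in its own order [l]; [x] is permuted to match. *)
pose x' : 'rV[R]_n := \row_i x 0 (s i).
have lx' i : `|l 0 i - x' 0 i| <= e by rewrite sE mxE.
have [|P [t [oP Ml dM]]] := near e x' _ lx' (majorized_permute s xd).
  by rewrite e0.
set M := P *m _ *m _ in Ml dM.
have sM : M^T = M by apply: conjmx_sym; rewrite tr_diag_mx.
pose A' := Q^T *m M *m Q.
have sA' : A'^T = A'.
  by rewrite /A' -{2}[Q]trmxK conjmx_sym // trmxK.
have A'A : entries_le (A' - A) (H' * Num.sqrt e).
  have -> : A' - A = Q^T *m (M - diag_mx l) *m Q^T^T.
    by rewrite trmxK mulmxBr mulmxBl -AE.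
  rewrite /H' -mulrA; apply: conjmx_entries_le => //.
  exact: orthogonal_mx_tr.
have [|B' [oB fB BA dB]] := corr A' _ sA' _ A'A.
  rewrite mulr_ge0 ?sqrtr_ge0 //=.
  have he : Num.sqrt e <= r2 / (H' + 1).
    have rH : 0 <= r2 / (H' + 1) by rewrite divr_ge0 // ltW.
    by rewrite -[leRHS]ger0_norm // -sqrtr_sqr ler_wsqrtr.
  have : Num.sqrt e * (H' + 1) <= r2 by rewrite -ler_pdivlMr.
  have := sqrtr_ge0 e; lra.
set B := B' *m A' *m B'^T in BA dB.
have cB : char_poly B = \prod_(i < n) ('X - (x 0 i)%:P).
  rewrite char_poly_conj // /A' -{2}[Q]trmxK char_poly_conj; last first.
    exact: orthogonal_mx_tr.
  rewrite char_poly_conj // char_poly_diag.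
  have [s' s'E] := sort_up_perm x'.
  rewrite [RHS](reindex_inj (@perm_inj _ s)).
  rewrite [RHS](reindex_inj (@perm_inj _ s')).
  by apply: eq_bigr => i _; rewrite s'E mxE.
(* Over a closed set both conjugations preserve the trace and the shift [t * (d - l)] sums to
   zero. *)
have sumB (S : {set 'I_n}) : closed_set A S ->
    \sum_(i in S) B i i = \sum_(i in S) A i i.
  move=> cS; have fS i j : closed_label A i = closed_label A j ->
    (i \in S) = (j \in S) by exact: closed_labelP.
  rewrite (sum_diag_conj A' (orthogonal_mx_tr_mul oB) fB fS).
  rewrite /A' -{2}[Q]trmxK (sum_diag_conj M _ (supported_tr fQ) fS); last first.
    by rewrite trmxK.
  rewrite (eq_bigr _ (fun i _ => dM i)) big_split /= -mulr_sumr sumrB.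
  rewrite sum_ld // subrr mulr0 addr0.
  by apply: eq_bigr => i _; rewrite dE.
have dBA i : B i i = A i i.
  have [iT|/dB//] := boolP (i \in T).
  (* All other entries over [S] are already correct, so the trace over [S] forces the one at the
     root [i]. *)
  have [S [cS iS nT]] := minT _ iT.
  have := sumB S cS; rewrite (bigD1 i) //= [RHS](bigD1 i) //=.
  rewrite (eq_bigr (fun j => A j j)) => [/addIr //|j /andP[jS ji]].
  exact/dB/nT.
exists B; split=> //.
- exact: conjmx_sym.
- by apply/rowP => i; rewrite mxE dBA dE.
- by rewrite -mulrA.
Qed.

(** * Frobenius norm and passage to the asymptotic statement *)

Lemma entry_le_frob_norm (R : realType) (m n : nat) (X : 'M[R]_(m, n)) :
  entries_le X (frob_norm X).
Proof.
move=> i j; rewrite -sqrtr_sqr ler_wsqrtr //.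
rewrite (bigD1 i) //= (bigD1 j) //= -addrA lerDl addr_ge0 ?sumr_ge0 // => k _.
  by rewrite sqr_ge0.
by rewrite sumr_ge0 // => l _; rewrite sqr_ge0.
Qed.

Lemma frob_norm_le (R : realType) (n : nat) (X : 'M[R]_n) (a : R) :
  0 <= a -> entries_le X a -> frob_norm X <= n%:R * a.
Proof.
move=> a0 hX; have na0 : 0 <= n%:R * a by rewrite mulr_ge0.
rewrite -[leRHS]ger0_norm // -sqrtr_sqr ler_wsqrtr //.
have -> : (n%:R * a) ^+ 2 = \sum_(i < n) \sum_(j < n) a ^+ 2.
  rewrite !sumr_const card_ord -[RHS]mulr_natl -[X in _ = _ * X]mulr_natl; ring.
apply: ler_sum => i _; apply: ler_sum => j _.
by rewrite -[leLHS]real_normK ?num_real // ler_pXn2r ?nnegrE.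
Qed.

Local Open Scope classical_set_scope.
Local Open Scope ring_scope.

Theorem theorem1p3 (R : realType) (n : nat) (A : 'M[R]_n) (symA : A^T = A) :
  schur_horn_continuous A.
Proof.
move=> lam eA lamt /eqO_exP[k k0 hk] maj.
have [C [r [C0 r0 hC]]] := schur_horn_perturbation symA eA.
(* The radius is [k * e], the bound on the perturbation. [xget] selects a witness for each [e], with
   default 0 where none exists, which does not happen for small [e]. *)
pose good e := [set B : 'M[R]_n | [/\ B^T = B, has_eigenvalues B (lamt e),
  diag_entries B = diag_entries A &
  entries_le (B - A) (C * Num.sqrt (k * e))]].
have goodE : \forall e \near 0^'+, good e (xget 0 (good e)).
  near=> e.
  have e0 : 0 < e by near: e; exact: nbhs_right_gt.
  apply: xgetPex; apply: hC.
  - rewrite mulr_ge0 ?(ltW k0) ?(ltW e0) //= mulrC -ler_pdivlMr //; apply: ltW.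
    by near: e; apply: nbhs_right_lt; rewrite divr_gt0.
  - move=> i; have := entry_le_frob_norm (lam - lamt e) 0 i.
    rewrite !mxE => /le_trans; apply; apply: le_trans (ler_norm _) _.
    rewrite -[e in k * e]gtr0_norm //.
    by near: e.
  - by near: e.
exists (fun e => xget 0 (good e)); split.
  by apply: filterS goodE => e [].
(* The added 1 makes the constant strictly positive. *)
apply/eqO_exP; exists (n%:R * (C * Num.sqrt k) + 1).
  by rewrite ltr_wpDl ?mulr_ge0 ?sqrtr_ge0.
near=> e.
have e0 : 0 < e by near: e; exact: nbhs_right_gt.
have [_ _ _ hB] : good e (xget 0 (good e)) by near: e.
rewrite ger0_norm ?sqrtr_ge0 // ger0_norm ?sqrtr_ge0 //.
apply: (@le_trans _ _ (n%:R * (C * Num.sqrt (k * e)))).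
  apply: frob_norm_le; first by rewrite mulr_ge0 ?sqrtr_ge0.
  by move=> i j; have := hB i j; rewrite !mxE distrC.
rewrite sqrtrM ?(ltW k0) // mulrDl mul1r !mulrA lerDl.
exact: sqrtr_ge0.
Unshelve. all: by end_near.
Qed.
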